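(* Let $X$ be a locally compact space. Then the function $$\mu:\big(\mathcal T(X),\leq\big)\rightarrow\big(\mathcal C(X^* )\setminus\{\emptyset\},\subseteq\big),\qquad \mu(Y)=F_Y^{-1}(p)\quad\text{for } Y=X\cup\{p\}\in\mathcal T(X),$$ is an order-anti-isomorphism.
   Context: Locally compact spaces and compact spaces are assumed Hausdorff. For a Tychonoff space $X$, a one-point extension of $X$ is a Tychonoff space $Y$ containing $X$ as a dense subspace such that $Y\setminus X$ is a singleton; we write $Y=X\cup\{p\}$. Two extensions are identified if there is a homeomorphism between them fixing $X$ pointwise. For extensions $Y_1,Y_2$ of $X$, $Y_2\leq Y_1$ means there is a continuous $f:Y_1\to Y_2$ fixing $X$ pointwise; this is a partial order on the set $\mathcal T(X)$ of all (equivalence classes of) one-point extensions of $X$. $\beta X$ is the Stone-Čech compactification of $X$ and $X^*=\beta X\setminus X$. $\mathcal C(T)$ denotes the set of all closed subsets of a space $T$. For $Y=X\cup\{p\}\in\mathcal T(X)$, $F_Y:\beta X\to\beta Y$ is the unique continuous function with $F_Y|X=\mathrm{id}_X$. An order-anti-isomorphism between partially ordered sets is a bijection $f$ such that both $f$ and $f^{-1}$ are order-reversing. *)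

(* Defs.v *)
From HB Require Import structures.
From mathcomp Require Import all_boot all_order all_algebra.
From mathcomp Require Import all_classical all_reals all_analysis.

Set Implicit Arguments.
Unset Strict Implicit.
Unset Printing Implicit Defensive.

Import Order.TTheory GRing.Theory Num.Theory.
Import numFieldNormedType.Exports.
Local Open Scope classical_set_scope.
Local Open Scope ring_scope.

Lemma eq_on_dense (S T : topologicalType) (D : set S) (f g : S -> T) :
  hausdorff_space T -> dense D -> continuous f -> continuous g ->
  (forall x, D x -> f x = g x) -> f = g.
Proof.
move=> hT dD cf cg fg; apply/funext => x; apply: hT => A B nA nB.
have : nbhs x ((f @^-1` A) `&` (g @^-1` B)).
  by apply: filterI; [exact: cf | exact: cg].
rewrite nbhsE => -[W [oW Wx] WAB].
have [y [Wy Dy]] : W `&` D !=set0 by (apply: dD => //; exists x).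
by exists (f y); split; [case: (WAB y Wy) | rewrite fg//; case: (WAB y Wy)].
Qed.

Lemma set_type_compact (T : topologicalType) (A : set T) :
  compact A -> compact [set: set_type A].
Proof.
move=> cA F PF _.
have [x [Ax clx]] := cA (set_val @ F) (fmap_proper_filter _ _)
  (filterS (fun z _ => set_valP z) filterT).
exists (exist _ x (mem_set Ax)); split=> // P B FP.
rewrite nbhsE => -[_ [[V oV <-] /= Vx] VB].
have [|_ [[z Pz <-] Vz]] := clx (@image (set_type A) T P set_val) V _ (open_nbhs_nbhs (conj oV Vx)).
  by apply: (@filterS _ F _ P) FP => z Pz; exists z.
by exists z; split=> //; exact: VB.
Qed.

Section StoneCech.
Variable R : realType.

Definition unit_interval : topologicalType := set_type (`[0, 1] : set R).

Lemma unit_interval_hausdorff : hausdorff_space unit_interval.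
Proof.
move=> x y xy; apply/val_inj/Rhausdorff => A B nA nB.
have [z [Az Bz]] := xy _ _ (@initial_continuous _ _ set_val x _ nA)
                           (@initial_continuous _ _ set_val y _ nB).
by exists (set_val z).
Qed.

Lemma unit_interval_compact : compact [set: unit_interval].
Proof. by apply: set_type_compact; exact: segment_compact. Qed.

Definition tychonoff_cube (T : topologicalType) : topologicalType :=
  prod_topology (fun _ : continuousType T unit_interval => unit_interval).

Definition evaluation (T : topologicalType) (x : T) : tychonoff_cube T :=
  fun f => f x.

(* The closure of the canonical image of T in the cube [0,1]^C(T, [0,1]). This
   is beta T when T is Tychonoff, in which case [eta] is an embedding. *)
Definition stone_cech (T : topologicalType) : topologicalType :=
  set_type (closure (range (@evaluation T))).

Lemma evaluation_closure (T : topologicalType) (x : T) :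
  evaluation x \in closure (range (@evaluation T)).
Proof. by apply/mem_set/subset_closure; exists x. Qed.

Definition eta (T : topologicalType) (x : T) : stone_cech T :=
  exist _ (evaluation x) (evaluation_closure x).

Lemma cube_continuous (S T : topologicalType) (F : S -> tychonoff_cube T) :
  (forall g, continuous (fun z => F z g)) -> continuous F.
Proof.
move=> cF z; apply/cvg_sup => g; move: z.
apply/(@continuousP _ (initial_topology (@^~ g))) => A [B oB <-].
by move/continuousP : (cF g) => /(_ _ oB).
Qed.

Lemma cube_proj_continuous (T : topologicalType) g :
  continuous (fun z : tychonoff_cube T => z g).
Proof. exact: (@proj_continuous _ (fun=> unit_interval) g). Qed.

Lemma set_val_continuous (T : topologicalType) (A : set T) :
  continuous (set_val : set_type A -> T).
Proof. exact: initial_continuous. Qed.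

Lemma eta_continuous (T : topologicalType) : continuous (@eta T).
Proof.
apply: continuous_comp_initial; apply: cube_continuous => g.
exact: (@cts_fun _ _ g).
Qed.

Lemma eta_dense (T : topologicalType) : dense (range (@eta T)).
Proof.
move=> W [z Wz] [U oU UE]; move: Wz; rewrite -UE => Uz.
have [_ [[x _ <-] Ux]] : range (@evaluation T) `&` U !=set0.
  by apply: (set_valP z); exact: open_nbhs_nbhs.
by exists (eta x); split=> //; exists x.
Qed.

Lemma stone_cech_hausdorff (T : topologicalType) :
  hausdorff_space (stone_cech T).
Proof.
have hC : hausdorff_space (tychonoff_cube T).
  by apply: hausdorff_product => ?; exact: unit_interval_hausdorff.
move=> x y xy; apply/val_inj/hC => A B nA nB.
have [z [Az Bz]] := xy _ _ (@set_val_continuous _ _ x _ nA)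
                           (@set_val_continuous _ _ y _ nB).
by exists (set_val z).
Qed.

Lemma stone_cech_compact (T : topologicalType) : compact [set: stone_cech T].
Proof.
apply/set_type_compact/(@subclosed_compact _ _ setT) => //.
  exact: closed_closure.
have := @tychonoff _ (fun _ : continuousType T unit_interval => unit_interval)
  (fun=> setT) (fun=> unit_interval_compact).
by congr compact; apply/seteqP.
Qed.

Lemma stone_cech_extension (S T : topologicalType) (f : S -> T) :
  continuous f ->
  exists! F : stone_cech S -> stone_cech T,
    continuous F /\ (forall x, F (eta x) = eta (f x)).
Proof.
move=> cf.
pose G (z : stone_cech S) : tychonoff_cube T :=
  fun g => set_val z (g \o mkcts cf : continuousType S unit_interval).
have cG : continuous G.
  apply: cube_continuous => g z.
  apply: (@continuous_comp _ _ _ set_val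
    (fun w : tychonoff_cube S => w (g \o mkcts cf))).
    exact: set_val_continuous.
  exact: cube_proj_continuous.
have GC z : G z \in closure (range (@evaluation T)).
  apply/mem_set => A /cG nA.
  move: nA; rewrite nbhs_simpl nbhsE => -[W [oW Wz] WA].
  have [w [/WA Ax [x _ xE]]] := @eta_dense S W (ex_intro _ z Wz) oW.
  exists (evaluation (f x)); split; first by exists (f x).
  by move: Ax; rewrite -xE.
exists (fun z => exist _ (G z) (GC z) : stone_cech T); split.
  split; last by move=> x; exact: val_inj.
  exact: continuous_comp_initial.
move=> H [cH HE]; apply: (@eq_on_dense _ _ (range (@eta S))) => //.
- exact: stone_cech_hausdorff.
- exact: eta_dense.
- exact: continuous_comp_initial.
- by move=> _ [x _ <-]; rewrite HE; exact: val_inj.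
Qed.

(* The unique continuous F : beta S -> beta T with F \o eta = eta \o f. *)
Definition stone_cech_map (S T : topologicalType) (f : S -> T)
    (cf : continuous f) : stone_cech S -> stone_cech T :=
  projT1 (cid (stone_cech_extension cf)).


Lemma stone_cech_mapP (S T : topologicalType) (f : S -> T)
    (cf : continuous f) :
  continuous (stone_cech_map cf) /\
  forall x, stone_cech_map cf (eta x) = eta (f x).
Proof. by have [] := projT2 (cid (stone_cech_extension cf)). Qed.

Lemma stone_cech_map_unique (S T : topologicalType) (f : S -> T)
    (cf : continuous f) (F : stone_cech S -> stone_cech T) :
  continuous F -> (forall x, F (eta x) = eta (f x)) -> F = stone_cech_map cf.
Proof.
move=> cF FE; have [_ uF] := projT2 (cid (stone_cech_extension cf)).
by apply/esym/uF.
Qed.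

(* X^* = beta X \ X *)
Definition remainder (T : topologicalType) : set (stone_cech T) :=
  ~` range (@eta T).

End StoneCech.

Arguments remainder R T : clear implicits.

Definition tychonoff_space (T : topologicalType) :=
  completely_regular_space T /\ hausdorff_space T.

Definition topological_embedding (S T : topologicalType) (f : S -> T) :=
  injective f /\
  forall U : set S, open U <-> exists2 V : set T, open V & f @^-1` V = U.

Lemma topological_embedding_continuous (S T : topologicalType) (f : S -> T) :
  topological_embedding f -> continuous f.
Proof. by move=> [_ ef]; apply/continuousP => V oV; apply/ef; exists V. Qed.

(* "Y contains X" is rendered by an embedding of X into Y. *)
Record one_point_ext (X : topologicalType) := OnePointExt {
  ext_space :> topologicalType;
  ext_emb : X -> ext_space;
  ext_pt : ext_space;
  ext_tychonoff : tychonoff_space ext_space;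
  ext_embedding : topological_embedding ext_emb;
  ext_dense : dense (range ext_emb);
  ext_remainder : ~` range ext_emb = [set ext_pt]
}.

Section OnePointExtensions.
Variable X : topologicalType.
Implicit Types Y Z : one_point_ext X.

Lemma ext_emb_continuous Y : continuous (@ext_emb X Y).
Proof. exact: topological_embedding_continuous (ext_embedding Y). Qed.

(* Y2 <= Y1 *)
Definition ext_le Y2 Y1 :=
  exists2 f : Y1 -> Y2, continuous f & forall x, f (ext_emb Y1 x) = ext_emb Y2 x.

Definition ext_equiv Y Z := exists (f : Y -> Z) (g : Z -> Y),
  [/\ cancel f g, cancel g f, continuous f, continuous g
    & forall x, f (ext_emb Y x) = ext_emb Z x].

Lemma ext_equiv_refl Y : ext_equiv Y Y.
Proof. by exists id, id; split=> // x; exact: cvg_id. Qed.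

Lemma ext_equiv_sym Y Z : ext_equiv Y Z -> ext_equiv Z Y.
Proof.
by move=> [f [g [fK gK cf cg fE]]]; exists g, f; split=> // x; rewrite -fE fK.
Qed.

Lemma ext_equiv_trans Y1 Y2 Y3 :
  ext_equiv Y1 Y2 -> ext_equiv Y2 Y3 -> ext_equiv Y1 Y3.
Proof.
move=> [f [g [fK gK cf cg fE]]] [f' [g' [fK' gK' cf' cg' fE']]].
exists (f' \o f), (g \o g'); split; [exact: can_comp|exact: can_comp| | |].
- by move=> x; apply: continuous_comp; [exact: cf | exact: cf'].
- by move=> x; apply: continuous_comp; [exact: cg' | exact: cg].
- by move=> x /=; rewrite fE fE'.
Qed.

Lemma ext_equiv_classP Y Z : ext_equiv Y = ext_equiv Z <-> ext_equiv Y Z.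
Proof.
split=> [-> | YZ]; first exact: ext_equiv_refl.
apply/funext => Y'; apply/propext; split; apply: ext_equiv_trans => //.
exact: ext_equiv_sym.
Qed.

(* [cal T(X)]: the equivalence classes of one-point extensions. Since
   [one_point_ext X] lives in a larger universe than the types that carry
   MathComp structures, the quotient is built by hand. *)
Definition ext_class := {C : one_point_ext X -> Prop | exists Y, C = ext_equiv Y}.

Definition class_of Y : ext_class := exist _ (ext_equiv Y) (ex_intro _ Y erefl).

Definition ext_repr (C : ext_class) : one_point_ext X :=
  projT1 (cid (proj2_sig C)).

Lemma ext_reprK C : class_of (ext_repr C) = C.
Proof. by apply/eq_sig_hprop => //=; rewrite -(projT2 (cid (proj2_sig C))). Qed.

Lemma class_ofP Y Z : class_of Y = class_of Z <-> ext_equiv Y Z.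
Proof.
split=> [[/ext_equiv_classP]//|/ext_equiv_classP YZ].
exact/eq_sig_hprop.
Qed.

Definition class_le (C2 C1 : ext_class) :=
  exists Y2 Y1, [/\ class_of Y2 = C2, class_of Y1 = C1 & ext_le Y2 Y1].

Lemma ext_le_refl Y : ext_le Y Y.
Proof. by exists id => // x; exact: cvg_id. Qed.

Lemma ext_le_trans Y2 Y1 Y3 : ext_le Y1 Y2 -> ext_le Y2 Y3 -> ext_le Y1 Y3.
Proof.
move=> [f cf fE] [g cg gE]; exists (f \o g) => [x|x /=]; last by rewrite gE fE.
by apply: continuous_comp; [exact: cg | exact: cf].
Qed.

Lemma ext_le_anti Y Z : ext_le Y Z /\ ext_le Z Y <-> ext_equiv Y Z.
Proof.
split=> [[[f cf fE] [g cg gE]]|[g [f [gK fK cg cf gE]]]]; last first.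
  by split; [exists f => // x; rewrite -gE gK | exists g].
have idE Y' (h : Y' -> Y') : continuous h ->
    (forall x, h (ext_emb Y' x) = ext_emb Y' x) -> forall y, h y = y.
  move=> ch hE y; apply: (congr1 (@^~ y) (_ : h = id)); apply: (eq_on_dense (ext_tychonoff Y').2 (@ext_dense _ Y')) => //.
    by move=> x; exact: cvg_id.
  by move=> _ [x _ <-].
exists g, f; split=> //.
- apply: (idE Y (f \o g)).
    by move=> x; apply: continuous_comp; [exact: cg | exact: cf].
  by move=> x /=; rewrite gE fE.
- apply: (idE Z (g \o f)).
    by move=> x; apply: continuous_comp; [exact: cf | exact: cg].
  by move=> x /=; rewrite fE gE.
Qed.

Lemma class_leP Y Z : class_le (class_of Y) (class_of Z) <-> ext_le Y Z.
Proof.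
split=> [[Y' [Z' [/class_ofP/ext_le_anti[_ YY'] /class_ofP/ext_le_anti[ZZ' _]]]]|].
  by move=> /(ext_le_trans YY')/ext_le_trans; exact.
by exists Y, Z.
Qed.

Lemma class_le_refl C : class_le C C.
Proof. rewrite -(ext_reprK C); exact/class_leP/ext_le_refl. Qed.

Lemma class_le_trans C2 C1 C3 : class_le C1 C2 -> class_le C2 C3 -> class_le C1 C3.
Proof.
rewrite -(ext_reprK C1) -(ext_reprK C2) -(ext_reprK C3).
move=> /class_leP h12 /class_leP h23; apply/class_leP.
exact: ext_le_trans h12 h23.
Qed.

Lemma class_le_anti C1 C2 : class_le C1 C2 -> class_le C2 C1 -> C1 = C2.
Proof.
rewrite -(ext_reprK C1) -(ext_reprK C2) => /class_leP h12 /class_leP h21.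
exact/class_ofP/ext_le_anti.
Qed.

End OnePointExtensions.

Section Mu.
Variables (R : realType) (X : topologicalType).
Implicit Types Y Z : one_point_ext X.

(* F_Y *)
Definition ext_map Y : stone_cech R X -> stone_cech R Y :=
  stone_cech_map (@ext_emb_continuous X Y).

Definition ext_mu Y : set (stone_cech R X) :=
  ext_map Y @^-1` [set eta R (ext_pt Y)].

Lemma ext_equiv_pt Y Z (f : Y -> Z) (g : Z -> Y) : cancel f g ->
  (forall x, g (ext_emb Z x) = ext_emb Y x) -> f (ext_pt Y) = ext_pt Z.
Proof.
move=> fK gE.
have : (~` range (@ext_emb X Z)) (f (ext_pt Y)); last by rewrite ext_remainder.
move=> [x _ xE]; have : (~` range (@ext_emb X Y)) (ext_pt Y).
  by rewrite ext_remainder.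
by apply; exists x => //; rewrite -gE xE fK.
Qed.

Lemma ext_mu_equiv Y Z : ext_equiv Y Z -> ext_mu Y = ext_mu Z.
Proof.
suff sub Y' Z' : ext_equiv Y' Z' -> ext_mu Y' `<=` ext_mu Z'.
  by move=> YZ; apply/seteqP; split; apply: sub => //; exact: ext_equiv_sym.
move=> [f [g [fK gK cf cg fE]]] z; rewrite /ext_mu /= => zY.
have [ch hE] := @stone_cech_mapP R _ _ _ cf.
have [cY YE] := @stone_cech_mapP R _ _ _ (@ext_emb_continuous X Y').
have -> : ext_map Z' = stone_cech_map cf \o ext_map Y'.
  apply/esym/stone_cech_map_unique => [x|x /=].
    by apply: continuous_comp; [exact: cY | exact: ch].
  by rewrite /ext_map YE hE fE.
rewrite /= zY hE (ext_equiv_pt fK)// => x.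
by rewrite -fE fK.
Qed.

Definition mu (C : ext_class X) : set (stone_cech R X) := ext_mu (ext_repr C).

Lemma mu_class Y : mu (class_of Y) = ext_mu Y.
Proof. by apply/ext_mu_equiv/class_ofP; rewrite ext_reprK. Qed.

(* C(X^* ) \ {set0}; closedness is relative to X^*. *)
Definition closed_nonempty_remainder : set (set (stone_cech R X)) :=
  [set A | [/\ A `<=` remainder R X,
               closed (A : set (subspace (remainder R X))) & A !=set0]].

End Mu.

Arguments closed_nonempty_remainder R X : clear implicits.

(* f is an order-anti-isomorphism from (A, leA) onto ({b | E b}, leB); the last
   clause says that the inverse of f is order-reversing. *)
Definition order_anti_isomorphism (A B : Type) (leA : A -> A -> Prop)
    (leB : B -> B -> Prop) (E : B -> Prop) (f : A -> B) :=
  [/\ (forall a, E (f a)),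
      injective f,
      (forall b, E b -> exists a, f a = b),
      (forall a a', leA a a' -> leB (f a') (f a))
    & (forall a a', leB (f a) (f a') -> leA a' a)].

(* Main.v *)
From Pilot Require Import Defs.
From HB Require Import structures.
From mathcomp Require Import all_boot all_order all_algebra.
From mathcomp Require Import all_classical all_reals all_analysis.
Set Implicit Arguments.
Unset Strict Implicit.
Unset Printing Implicit Defensive.
Import Order.TTheory GRing.Theory Num.Theory.
Import numFieldNormedType.Exports.
Import Pilot.Defs.
Local Open Scope classical_set_scope.
Local Open Scope ring_scope.

(** The map [mu] sends an extension [Y] of [X] to the fiber of
[F_Y : beta X -> beta Y] over the added point, and [Y] can be recovered from
this fiber.

That [mu Y] is a nonempty closed subset of [X^*] is general: [F_Y] is onto,
because its image is compact and contains the dense set [X], and it sends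
points of [X] to points of [X], never to the added point
([ext_mu_closed_nonempty]).

If a continuous [f : Y -> Z] fixes [X], it sends the added point to the added
point ([ext_le_pt]), and [F_Z = beta f o F_Y] by density of [X]; so
[mu Y `<=` mu Z] ([ext_mu_antitone]). Conversely, when [mu Y `<=` mu Z], the
map that fixes [X] and matches the added points is continuous
([ext_mu_reflects_le]). Only the added point is at stake. Given an open [W]
around the added point of [Z], extended to an open [W'] of [beta Z], the open
set [F_Z @^-1` W'] contains [mu Z], hence the fiber [mu Y] of [F_Y]; as [F_Y]
is a map from a compact space to a Hausdorff one, [F_Z @^-1` W'] contains the
preimage of a whole neighborhood of the added point of [Y]
([compact_fiber_tube]). With antisymmetry of the order on extensions, this also
gives the injectivity of [mu].

Local compactness enters in surjectivity. It makes [X] Tychonoff and open in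
[beta X], so a closed subset [C] of [X^*] is closed in [beta X]
([remainder_closed]). The extension with [mu Y = C] is [beta X] with [C]
collapsed to a point, restricted to the image of [X] and that point. It is built
directly as [X] plus one point whose neighborhoods contain the traces on [X] of
the open sets around [C]. A real function on [beta X] that is constant on [C]
descends to it, and Urysohn's lemma on the compact Hausdorff space [beta X]
supplies enough such functions to show that the extension is Tychonoff
([add_point_completely_regular]) and that its fiber is no larger than [C]
([ext_mu_add_point]). *)

(** * Coordinates on the Stone-Cech compactification *)

Section UnitIntervalValuedMaps.
Variable R : realType.

Lemma unit_interval_factor (T : topologicalType) (f : T -> R) :
  continuous f -> range f `<=` `[0, 1] ->
  exists g : continuousType T (unit_interval R), forall x, set_val (g x) = f x.
Proof.
move=> cf f01.
pose g x : unit_interval R :=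
  exist _ (f x) (mem_set (f01 _ (imageP f (I : setT x)))).
have cg : continuous g by apply: continuous_comp_initial.
by exists (mkcts cg).
Qed.

(** The extension of [f] to [beta T]: as [beta T] sits in the cube indexed by the
maps [T -> [0, 1]], it is a coordinate projection. *)
Definition stone_cech_coord (T : topologicalType)
    (f : continuousType T (unit_interval R)) (z : stone_cech R T) : R :=
  set_val (set_val z f).

Lemma stone_cech_coord_continuous (T : topologicalType) f :
  continuous (@stone_cech_coord T f).
Proof.
move=> z; apply: (@continuous_comp _ _ _
  (fun w : stone_cech R T => (set_val w : tychonoff_cube R T) f) set_val).
  apply: (@continuous_comp _ _ _ set_val (fun w : tychonoff_cube R T => w f)).
    exact: set_val_continuous.
  exact: cube_proj_continuous.
exact: set_val_continuous.
Qed.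

Lemma stone_cech_coord_eta (T : topologicalType) f (x : T) :
  stone_cech_coord f (eta R x) = set_val (f x).
Proof. by []. Qed.

End UnitIntervalValuedMaps.

Lemma stone_cech_closed_set1 (R : realType) (T : topologicalType)
    (z : stone_cech R T) : closed [set z].
Proof.
apply: accessible_closed_set1; apply: hausdorff_accessible.
exact: stone_cech_hausdorff.
Qed.
Arguments stone_cech_closed_set1 {R T} z.

(** * Tychonoff spaces inside their Stone-Cech compactification *)

Section StoneCechEmbedding.
Variables (R : realType) (T : topologicalType).
Hypothesis T_cr : completely_regular_space T.

(** The topology of a completely regular space is the one induced by [beta T]: a
function separating [x] from the complement of [U] is a coordinate of the cube,
so the points where this coordinate differs from [1] form an open set of
[beta T] whose trace is a neighborhood of [x] inside [U]. *)
Lemma eta_open_trace (U : set T) : open U ->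
  exists2 O : set (stone_cech R T), open O & @eta R T @^-1` O = U.
Proof.
move=> oU.
pose OO := [set O : set (stone_cech R T) | open O /\ @eta R T @^-1` O `<=` U].
exists (\bigcup_(O in OO) O); first by apply: bigcup_open => O [].
apply/seteqP; split=> [x [V [_ VU] Vx]|x Ux]; first exact: VU.
have /(@uniform_separatorP _ R)[f [cf f01 fx0 fU1]] :
    uniform_separator [set x] (~` U).
  by apply: T_cr; [exact: open_closedC | apply].
have [g gE] := unit_interval_factor cf f01.
exists (stone_cech_coord g @^-1` [set~ 1]).
  split.
    apply: open_comp => [z _|]; first exact: stone_cech_coord_continuous.
    apply/closed_openC/accessible_closed_set1.
    exact/hausdorff_accessible/Rhausdorff.
  move=> y /=; rewrite stone_cech_coord_eta gE => fy.
  by apply: contrapT => nUy; apply: fy; apply: fU1; exists y.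
rewrite /= stone_cech_coord_eta gE.
have -> : f x = 0 by apply: fx0; exists x.
by apply/eqP; rewrite eq_sym oner_eq0.
Qed.

Hypothesis T_h : hausdorff_space T.

Lemma eta_inj : injective (@eta R T).
Proof.
move=> x y xy; apply: T_h => A B.
rewrite nbhsE => -[U [oU Ux] UA] nB.
exists y; split; last exact: nbhs_singleton.
have [V _ VU] := eta_open_trace oU; apply: UA.
by move: Ux; rewrite -VU /= xy.
Qed.

(** A compact neighborhood [K] of [x] is still closed in [beta T], so an open set
of [beta T] whose trace is the interior of [K] cannot leave [K], by density.
Thus [T] is open in [beta T]. *)
Lemma remainder_closed : locally_compact [set: T] -> closed (remainder R T).
Proof.
move=> lcT; apply: open_closedC; rewrite openE => _ [x _ <-].
have [K] := lcT x I; rewrite withinET => nK [cK _].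
have [V oV VE] := eta_open_trace (@open_interior _ K).
have cEK : closed (@eta R T @` K).
  apply: compact_closed; first exact: stone_cech_hausdorff.
  apply: continuous_compact cK; apply: continuous_subspaceT.
  exact: eta_continuous.
apply: (@filterS _ _ _ V).
  move=> z Vz; apply: contrapT => nz.
  have [w [[Vy nKy] [y _ yE]]] :
      (V `&` ~` (@eta R T @` K)) `&` range (@eta R T) !=set0.
    apply: eta_dense; last by apply: openI => //; exact: closed_openC.
    by exists z; split=> // -[y _ yz]; apply: nz; exists y.
  apply: nKy; rewrite -yE; exists y => //; apply: (@interior_subset _ K).
  by rewrite -VE /= yE.
apply: open_nbhs_nbhs; split=> //.
by have : (@eta R T @^-1` V) x by rewrite VE; exact: nK.
Qed.

End StoneCechEmbedding.

(** Such an [F] is a closed map, so the complement of [F @` (~` U)] is open. *)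
Lemma compact_fiber_tube (K L : topologicalType) (F : K -> L) (p : L)
    (U : set K) :
  compact [set: K] -> hausdorff_space L -> continuous F -> open U ->
  F @^-1` [set p] `<=` U ->
  exists O : set L, [/\ open O, O p & F @^-1` O `<=` U].
Proof.
move=> cK hL cF oU FU; exists (~` (F @` (~` U))); split.
- apply: closed_openC; apply: compact_closed => //.
  apply: continuous_compact; first exact: continuous_subspaceT.
  by apply: (subclosed_compact _ cK) => //; exact: open_closedC.
- by move=> [z nUz zp]; apply: nUz; exact: FU.
- by move=> z nFz; apply: contrapT => nUz; apply: nFz; exists z.
Qed.

(** * One-point extensions and the order *)

Section OnePointExtensionFacts.
Variables (R : realType) (X : topologicalType).
Implicit Types Y Z : one_point_ext X.

Lemma ext_emb_neq_pt Y x : ext_emb Y x <> ext_pt Y.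
Proof.
move=> xp; have : (~` range (@ext_emb X Y)) (ext_pt Y) by rewrite ext_remainder.
by apply; exists x.
Qed.

Lemma ext_emb_or_pt Y y : range (@ext_emb X Y) y \/ y = ext_pt Y.
Proof.
have [|ny] := pselect (range (@ext_emb X Y) y); first by left.
by right; have : (~` range (@ext_emb X Y)) y by []; rewrite ext_remainder.
Qed.

Lemma ext_emb_open Y (U : set X) : open U -> open (ext_emb Y @` U).
Proof.
move=> /(ext_embedding Y).2[V oV <-].
suff -> : ext_emb Y @` (ext_emb Y @^-1` V) = V `&` [set~ ext_pt Y].
  apply: openI => //; apply/closed_openC.
  exact: accessible_closed_set1 (hausdorff_accessible (ext_tychonoff Y).2) _.
apply/seteqP; split=> [_ [x Vx <-]|y [Vy yp]].
  by split=> //; exact: ext_emb_neq_pt.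
by have [[x _ xy]|//] := ext_emb_or_pt y; exists x => //=; rewrite xy.
Qed.

Lemma ext_mapE Y x : ext_map Y (eta R x) = eta R (ext_emb Y x).
Proof. exact: (stone_cech_mapP R (@ext_emb_continuous X Y)).2. Qed.

Lemma ext_map_continuous Y : continuous (@ext_map R X Y).
Proof. exact: (stone_cech_mapP R (@ext_emb_continuous X Y)).1. Qed.

Lemma ext_map_surj Y w : range (@ext_map R X Y) w.
Proof.
have cl : closed (range (@ext_map R X Y)).
  apply: compact_closed; first exact: stone_cech_hausdorff.
  apply: continuous_compact; last exact: stone_cech_compact.
  by apply: continuous_subspaceT; exact: ext_map_continuous.
apply: contrapT => nw.
have [w' [nz [y _ yE]]] : ~` range (@ext_map R X Y) `&` range (@eta R Y) !=set0.
  by apply: eta_dense; [exists w | exact: closed_openC].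
have /continuousP/(_ _ (closed_openC cl)) oW := @eta_continuous R Y.
have [y' [ny [x _ xE]]] :
    @eta R Y @^-1` (~` range (@ext_map R X Y)) `&` range (@ext_emb X Y) !=set0.
  by apply: ext_dense => //; exists y; rewrite /= yE.
by apply: ny; exists (eta R x) => //; rewrite ext_mapE xE.
Qed.

Lemma ext_mu_closed_nonempty Y : closed_nonempty_remainder R X (@ext_mu R X Y).
Proof.
split.
- move=> z zY [x _ xz]; move: zY; rewrite /ext_mu /= -xz ext_mapE.
  move=> /(eta_inj (ext_tychonoff Y).1 (ext_tychonoff Y).2).
  exact: ext_emb_neq_pt.
- apply: closed_subspaceW; apply: preimage_closed.
    by move=> z _; exact: ext_map_continuous.
  exact: stone_cech_closed_set1.
- by have [z _ zE] := @ext_map_surj Y (eta R (ext_pt Y)); exists z.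
Qed.

(** If [f] sent the added point to a point [x] of [X], then points of [X] close to
the added point would be sent close to [x]; as [f] fixes them and the topology
of [X] is the same in [Y] and [Z], they would be close to [x] in [Y] too. So [x]
and the added point could not be separated in [Y]. *)
Lemma ext_le_pt Y Z (f : Y -> Z) : continuous f ->
  (forall x, f (ext_emb Y x) = ext_emb Z x) -> f (ext_pt Y) = ext_pt Z.
Proof.
move=> cf fE; have [[x _ xE]|//] := ext_emb_or_pt (f (ext_pt Y)).
exfalso; apply: (@ext_emb_neq_pt Y x).
apply/esym/(ext_tychonoff Y).2 => A B nA nB.
(* [B] is first cut down to [X], then transported to [Z], where [f] can see it *)
have nf : nbhs (ext_pt Y) (f @^-1` (ext_emb Z @` (ext_emb Y @^-1` interior B))).
  apply: cf; rewrite -xE; apply: open_nbhs_nbhs; split; last by exists x.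
  apply: ext_emb_open; apply: open_comp; last exact: open_interior.
  by move=> ? _; exact: ext_emb_continuous.
have : nbhs (ext_pt Y)
  (A `&` f @^-1` (ext_emb Z @` (ext_emb Y @^-1` interior B))) by exact: filterI.
rewrite nbhsE => -[W [oW Wp] WA].
have [w [Wy [y _ yE]]] : W `&` range (@ext_emb X Y) !=set0.
  by apply: ext_dense => //; exists (ext_pt Y).
exists (ext_emb Y y); rewrite yE; split; first by case: (WA _ Wy).
have [_ [y' By' /=]] := WA _ Wy; rewrite -yE fE => /(ext_embedding Z).1 <-.
exact: interior_subset.
Qed.

Lemma ext_mu_antitone Y Z : ext_le Z Y -> @ext_mu R X Y `<=` @ext_mu R X Z.
Proof.
move=> [f cf fE] z; rewrite /ext_mu /= => zY.
have [ch hE] := stone_cech_mapP R cf.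
have -> : @ext_map R X Z = stone_cech_map cf \o ext_map Y.
  apply/esym/stone_cech_map_unique => [x|x /=]; last by rewrite ext_mapE hE fE.
  by apply: continuous_comp; [exact: ext_map_continuous | exact: ch].
by rewrite /= zY hE (ext_le_pt cf).
Qed.

(** The map is forced: it fixes [X] and matches the added points. Its continuity
on [X] holds because [X] is open in [Y]; at the added point it comes from the
tube lemma for the fiber [ext_mu Y] of [F_Y]. *)
Lemma ext_mu_reflects_le Y Z : @ext_mu R X Y `<=` @ext_mu R X Z -> ext_le Z Y.
Proof.
move=> muYZ.
pose f (y : Y) : Z := if pselect (range (@ext_emb X Y) y) is left e
  then ext_emb Z (projT1 (cid2 e)) else ext_pt Z.
have fE x : f (ext_emb Y x) = ext_emb Z x.
  rewrite /f; case: pselect => [e|[]]; last by exists x.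
  by case: (cid2 e) => x' _ /= /(ext_embedding Y).1 ->.
have fp : f (ext_pt Y) = ext_pt Z.
  by rewrite /f; case: pselect => // e; have [x _ /ext_emb_neq_pt] := e.
exists f => // y; have [[x _ <-]|->] := ext_emb_or_pt y => V.
  rewrite fE => /ext_emb_continuous; rewrite nbhsE => -[U [oU Ux] UV].
  apply: (@filterS _ _ _ (ext_emb Y @` U)); last first.
    by apply: open_nbhs_nbhs; split; [exact: ext_emb_open | exists x].
  by move=> _ [x' /UV Vx' <-]; rewrite /= fE.
rewrite fp nbhsE => -[W [oW Wp] WV].
have [W' oW' W'E] := eta_open_trace R (ext_tychonoff Z).1 oW.
have [Q [oQ Qp QW]] : exists Q, [/\ open Q, Q (eta R (ext_pt Y)) &
    @ext_map R X Y @^-1` Q `<=` ext_map Z @^-1` W'].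
  apply: compact_fiber_tube.
  - exact: stone_cech_compact.
  - exact: stone_cech_hausdorff.
  - exact: ext_map_continuous.
  - by apply: open_comp => // ? _; exact: ext_map_continuous.
  - by move=> z /muYZ; rewrite /ext_mu /= => ->; move: Wp; rewrite -W'E.
apply: (@filterS _ _ _ (@eta R Y @^-1` Q)); last first.
  by apply: eta_continuous; exact: open_nbhs_nbhs.
move=> y' /= Qy'; apply: WV.
have [[x' _ x'E]|->] := ext_emb_or_pt y'; last by rewrite fp.
rewrite -x'E fE -W'E /= -ext_mapE; apply: QW.
by rewrite /= ext_mapE x'E.
Qed.

End OnePointExtensionFacts.

(** * The extension with a prescribed fiber *)

Lemma completely_regular_hausdorff (R : realType) (T : topologicalType) :
  completely_regular_space T -> (forall y : T, closed [set y]) ->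
  hausdorff_space T.
Proof.
move=> crT c1 x y xy; apply: contrapT => nxy.
have /(@uniform_separatorP _ R)[f [cf _ fx fy]] :
  uniform_separator [set x] [set y] by exact: crT.
have : f x = f y.
  apply: Rhausdorff => A B /cf nA /cf nB.
  by have [z [Az Bz]] := xy _ _ nA nB; exists (f z).
have -> : f x = 0 by apply: fx; exists x.
have -> : f y = 1 by apply: fy; exists y.
by move=> /eqP; rewrite eq_sym oner_eq0.
Qed.

Lemma stone_cech_urysohn (R : realType) (X : topologicalType)
    (A B : set (stone_cech R X)) :
  closed A -> closed B -> A `&` B = set0 ->
  exists g : stone_cech R X -> R, [/\ continuous g, range g `<=` `[0, 1],
    A `<=` g @^-1` [set 0] & B `<=` g @^-1` [set 1]].
Proof.
move=> cA cB AB.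
have /(@normal_separatorP R)/(_ _ _ cA cB AB) : normal_space (stone_cech R X).
  by apply: compact_normal;
    [exact: stone_cech_hausdorff | exact: stone_cech_compact].
move=> /(@uniform_separatorP _ R)[g [cg g01 gA gB]]; exists g; split=> //.
  by move=> z Az; apply: gA; exists z.
by move=> z Bz; apply: gB; exists z.
Qed.

(** The index [C] is carried by the type only so that the topology, which
depends on [C], can be attached to it. *)
Definition add_point (R : realType) (X : topologicalType)
    (C : set (stone_cech R X)) : Type := option X.

HB.instance Definition _ (R : realType) (X : topologicalType)
  (C : set (stone_cech R X)) := Choice.on (add_point C).

Section AddPoint.
Variables (R : realType) (X : topologicalType) (C : set (stone_cech R X)).

(** The quotient topology of [beta X] with [C] collapsed to [None], restricted to
[X] and [None]. *)
Definition add_point_open (U : set (add_point C)) :=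
  open (Some @^-1` U : set X) /\
  (U None -> exists O : set (stone_cech R X),
    [/\ open O, C `<=` O & @eta R X @^-1` O `<=` Some @^-1` U]).

Let add_point_openT : add_point_open setT.
Proof.
split=> [|_]; first exact: openT.
by exists setT; split=> //; exact: openT.
Qed.

Let add_point_openI : setI_closed add_point_open.
Proof.
move=> U V [oU CU] [oV CV]; split=> [|[/CU[A [oA CA AU]] /CV[B [oB CB BV]]]].
  exact: openI.
exists (A `&` B); split; first exact: openI.
  by move=> z Cz; split; [exact: CA | exact: CB].
by move=> x [Ax Bx]; split; [exact: AU | exact: BV].
Qed.

Let add_point_open_bigU (I : Type) (U : I -> set (add_point C)) :
  (forall i, add_point_open (U i)) -> add_point_open (\bigcup_i U i).
Proof.
move=> oU; split; first by apply: bigcup_open => i _; exact: (oU i).1.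
move=> [i _ /(oU i).2[A [oA CA AU]]]; exists A; split=> // x /AU Ux.
by exists i.
Qed.

HB.instance Definition _ := isOpenTopological.Build (add_point C)
  add_point_openT add_point_openI add_point_open_bigU.

Definition add_point_emb (x : X) : add_point C := Some x.

Lemma add_point_openE (U : set (add_point C)) : open U = add_point_open U.
Proof. by []. Qed.

Lemma add_point_emb_open (U : set X) : open U -> open (add_point_emb @` U).
Proof.
move=> oU; split=> [|[]//]; congr (open _): oU.
by apply/seteqP; split=> [x Ux|x [y Uy [<-]]//]; exists x.
Qed.

(** A function on [beta X] that is constant on [C] factors through the
collapse of [C]. *)
Lemma add_point_map_continuous (L : topologicalType) (g : stone_cech R X -> L) c
    (h : add_point C -> L) :
  continuous g -> C `<=` g @^-1` [set c] ->
  (forall x, h (add_point_emb x) = g (eta R x)) -> h None = c -> continuous h.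
Proof.
move=> cg gC hE hN; apply/continuousP => V oV; rewrite add_point_openE.
have SE : Some @^-1` (h @^-1` V) = @eta R X @^-1` (g @^-1` V).
  by apply/seteqP; split=> x /=; rewrite -hE.
have oW : open (g @^-1` V) by move/continuousP : cg; apply.
split=> [|VN].
  by rewrite SE; move/continuousP : (@eta_continuous R X); apply.
exists (g @^-1` V); split=> //; last by rewrite SE.
by move=> z /gC /= ->; rewrite -hN.
Qed.

Hypothesis C_closed : closed C.
Hypothesis C_remainder : C `<=` remainder R X.
Hypothesis C_nonempty : C !=set0.

Lemma add_point_lift (g : stone_cech R X -> R) c :
  continuous g -> range g `<=` `[0, 1] -> C `<=` g @^-1` [set c] ->
  exists h : add_point C -> R, [/\ continuous h, range h `<=` `[0, 1],
    (forall x, h (add_point_emb x) = g (eta R x)) & h None = c].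
Proof.
move=> cg g01 gC.
exists (fun y : add_point C => if y is Some x then g (eta R x) else c).
split=> //; first exact: (add_point_map_continuous cg gC).
move=> _ [[x|] _ <-]; first by apply: g01; exists (eta R x).
by have [z /gC <-] := C_nonempty; apply: g01; exists z.
Qed.

Lemma add_point_emb_dense : dense (range add_point_emb).
Proof.
move=> W [[x|] Wy] [oW CW]; first by exists (Some x); split=> //; exists x.
have [A [oA CA AW]] := CW Wy; have [z Cz] := C_nonempty.
have [w [Aw [x _ xw]]] := @eta_dense R X A (ex_intro _ z (CA _ Cz)) oA.
by exists (Some x); split; [apply: AW; rewrite /= xw | exists x].
Qed.

Hypothesis X_cr : completely_regular_space X.

(** A Urysohn function on [beta X] descends to the extension once it is constant
on [C]. To separate a point [x] of [X] from [B], the set [C] is therefore added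
to the side where the function is [1], which is possible as [x] lies outside
[C]; to separate the added point from [B], the function is taken [0] on [C]. *)
Lemma add_point_completely_regular : completely_regular_space (add_point C).
Proof.
move=> a B /closed_openC[oB CB] nBa.
have nBS x : ~ (Some @^-1` (~` B)) x <-> B (Some x).
  by split=> [/contrapT//|Bx]; apply.
case: a => [x|] in nBa *.
  have [Q oQ QE] := eta_open_trace R X_cr oB.
  have cQC : closed (~` Q `|` C) by apply: closedU => //; exact: open_closedC.
  have xQC : [set eta R x] `&` (~` Q `|` C) = set0.
    apply/disjoints_subset => _ -> [|/C_remainder]; last by apply; exists x.
    by apply; have : (@eta R X @^-1` Q) x by rewrite QE.
  have [g [cg g01 gx gQC]] :=
    stone_cech_urysohn (stone_cech_closed_set1 (eta R x)) cQC xQC.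
  have [|h [ch h01 hE hN]] := add_point_lift cg g01 (c := 1).
    by move=> z Cz; apply: gQC; right.
  apply/(@uniform_separatorP _ R); exists h; split=> //.
    by move=> _ [_ -> <-]; rewrite hE; exact: gx.
  move=> _ [[y|] By <-] //; rewrite hE; apply: gQC; left.
  by move: By => /nBS; rewrite -QE.
have [Q [oQ CQ QB]] := CB nBa.
have [g [cg g01 gC gQ]] : exists g : stone_cech R X -> R,
    [/\ continuous g, range g `<=` `[0, 1],
    C `<=` g @^-1` [set 0] & ~` Q `<=` g @^-1` [set 1]].
  apply: stone_cech_urysohn => //; first exact: open_closedC.
  by apply/disjoints_subset; rewrite setCK.
have [h [ch h01 hE hN]] := add_point_lift cg g01 gC.
apply/(@uniform_separatorP _ R); exists h; split=> // [_ [_ -> <-] //|].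
move=> _ [[y|] By <-] //; rewrite hE; apply: gQ => /QB.
exact/nBS.
Qed.

Hypothesis X_h : hausdorff_space X.

Lemma add_point_closed_set1 (y : add_point C) : closed [set y].
Proof.
rewrite -[X in closed X]setCK; apply: open_closedC; rewrite add_point_openE.
case: y => [x|]; split=> //.
- rewrite (_ : _ @^-1` _ = ~` [set x]).
    by apply/closed_openC/accessible_closed_set1; exact: hausdorff_accessible.
  by apply/seteqP; split=> y /=; [move=> + xy; rewrite xy | move=> + [xy]].
- move=> _; exists (~` [set eta R x]); split.
  + exact/closed_openC/stone_cech_closed_set1.
  + by move=> z Cz zx; apply: (C_remainder Cz); exists x.
  + by move=> y /= yx [xy]; apply: yx; rewrite xy.
- by rewrite (_ : _ @^-1` _ = setT); [exact: openT | apply/seteqP; split].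
- by move=> /(_ erefl).
Qed.

Lemma add_point_tychonoff : tychonoff_space (add_point C).
Proof.
split; first exact: add_point_completely_regular.
apply: (completely_regular_hausdorff R add_point_completely_regular).
exact: add_point_closed_set1.
Qed.

Lemma add_point_embedding : topological_embedding add_point_emb.
Proof.
split=> [x y [//]|U]; split=> [oU|[V [oV _] <-] //].
exists (add_point_emb @` U); first exact: add_point_emb_open.
by apply/seteqP; split=> [x [y Uy [<-]]//|x Ux]; exists x.
Qed.

Lemma add_point_remainder : ~` range add_point_emb = [set None].
Proof.
apply/seteqP; split=> [[x|]//|_ -> [x _ //]].
by move=> nx; exfalso; apply: nx; exists x.
Qed.

Definition add_point_ext : one_point_ext X :=
  OnePointExt add_point_tychonoff add_point_embedding add_point_emb_dense
    add_point_remainder.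

(** Off [C], a function that vanishes at [z] and is [1] on [C] descends to the
extension, and its extension to [beta Y] separates [F_Y z] from the added
point. On [C], every neighborhood of [z] contains points of [X] arbitrarily
close to the added point, so by continuity [F_Y z] cannot be separated from
it. *)
Lemma ext_mu_add_point : @ext_mu R X add_point_ext = C.
Proof.
apply/seteqP; split=> [z zp|z Cz].
  apply: contrapT => nCz.
  have zC : [set z] `&` C = set0 by apply/disjoints_subset => _ ->.
  have [g [cg g01 gz gC]] :=
    stone_cech_urysohn (stone_cech_closed_set1 z) C_closed zC.
  have [h [ch h01 hE hN]] := add_point_lift cg g01 gC.
  have [k kE] := unit_interval_factor ch h01.
  have kg : stone_cech_coord k \o @ext_map R X add_point_ext = g.
    apply: (@eq_on_dense _ R (range (@eta R X))) => //.
    - exact: eta_dense.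
    - move=> w; apply: (@continuous_comp _ _ _ (@ext_map R X add_point_ext)).
        exact: ext_map_continuous.
      exact: (@stone_cech_coord_continuous R add_point_ext k).
    - by move=> _ [x _ <-]; rewrite /= ext_mapE stone_cech_coord_eta kE hE.
  have := gz z erefl; rewrite /= -kg /= [ext_map _ _]zp stone_cech_coord_eta.
  by rewrite kE hN => /eqP; rewrite oner_eq0.
apply: (@stone_cech_hausdorff R add_point_ext) => N1 N2 n1 n2.
have : nbhs (ext_pt add_point_ext) (@eta R add_point_ext @^-1` N2).
  exact: eta_continuous n2.
rewrite nbhsE => -[V [[_ /[apply] -[Q [oQ CQ QV]]] VN2]].
have : nbhs z (@ext_map R X add_point_ext @^-1` N1 `&` Q).
  apply: filterI; first exact: ext_map_continuous.
  by apply: open_nbhs_nbhs; split=> //; exact: CQ.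
rewrite nbhsE => -[W [oW Wz] WN].
have [w [Ww [x _ xw]]] := @eta_dense R X W (ex_intro _ z Wz) oW.
have [N1x Qx] := WN _ Ww.
exists (eta R (add_point_emb x : add_point_ext)); split.
  by move: N1x; rewrite /= -xw ext_mapE.
by apply: VN2; apply: QV; rewrite /= xw.
Qed.

End AddPoint.

Theorem theorem2p2 (R : realType) (X : topologicalType)
    (X_hausdorff : hausdorff_space X)
    (X_locally_compact : locally_compact [set: X]) :
  order_anti_isomorphism (@class_le X) (@subset (stone_cech R X))
    (closed_nonempty_remainder R X) (@mu R X).
Proof.
have mu_le C D : @mu R X C `<=` mu D -> class_le D C.
  rewrite -{2}(ext_reprK C) -{2}(ext_reprK D) => CD.
  exact/class_leP/ext_mu_reflects_le/CD.
split=> [C|C D CD|A [AX cA A0]|C D|C D] //; first exact: ext_mu_closed_nonempty.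
- by apply: class_le_anti; apply: mu_le; rewrite CD.
- have X_cr :=
    @locally_compact_completely_regular X R X_locally_compact X_hausdorff.
  have {}cA : closed A.
    have cX := remainder_closed (R := R) X_cr X_locally_compact.
    by rewrite -(setIidl AX) (closed_setIS _ cX).
  exists (class_of (add_point_ext cA AX A0 X_cr X_hausdorff)).
  by rewrite mu_class ext_mu_add_point.
- by rewrite -{1}(ext_reprK C) -{1}(ext_reprK D) => /class_leP/ext_mu_antitone.
- exact: mu_le.
Qed.
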